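(* Let $k$ be a field of characteristic $2$, let $n=2m+1$ with $m\geq 2$, and let $L$ be either of the Lie algebras $N_1(n,k)$ or $N_2(n,k)$. Then the derived subalgebra $[L,L]$ is absolutely simple of dimension $2^n-2$ over $k$.
   Context: The derived subalgebra $[L,L]$ is the $k$-span of all brackets of elements of $L$. A Lie algebra $M$ over $k$ is simple if its only ideals are $0$ and $M$, and absolutely simple if $M\otimes_k K$ is a simple Lie algebra over $K$ for every field extension $K/k$. Let $\alpha_1,\dots,\alpha_n$ be the standard basis of $\mathrm{GF}(2)^n$, let $(\cdot,\cdot)$ be the standard inner product $(\alpha,\beta)=\sum_i a_ib_i\in\mathrm{GF}(2)$ for $\alpha=\sum a_i\alpha_i$, $\beta=\sum b_i\alpha_i$, and put $|\alpha|=\sum_i a_i\in\mathrm{GF}(2)$. Let $\Phi=\mathrm{GF}(2)^n\setminus\{\underline 0\}$. Each of $N_1(n,k)$ and $N_2(n,k)$ is the $(2^n-1)$-dimensional $k$-vector space with basis $\{e_\alpha:\alpha\in\Phi\}$ and with the bilinear, symmetric (equivalently antisymmetric, as the characteristic is $2$) bracket with $[e_\alpha,e_\alpha]=0$ and, for $\alpha\neq\beta$ in $\Phi$, as follows. $N_1(n,k)$: (1) if $|\alpha|=|\beta|=1$, then $[e_\alpha,e_\beta]=e_{\alpha+\beta}$; (2) if $|\alpha|=0$ or $|\beta|=0$, then $[e_\alpha,e_\beta]=e_{\alpha+\beta}$ if $(\alpha,\beta)=1$ and $[e_\alpha,e_\beta]=0$ otherwise. $N_2(n,k)$: (1) if $(\alpha,\alpha_n)=0$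 and $|\alpha|=|\beta|=1$, then $[e_\alpha,e_\beta]=e_{\alpha+\beta}$; (2) if $(\alpha,\alpha_n)=0$ and ($|\alpha|=0$ or $|\beta|=0$), then $[e_\alpha,e_\beta]=e_{\alpha+\beta}$ if $(\alpha,\beta)=1$ and $[e_\alpha,e_\beta]=0$ otherwise; (3) if $(\alpha,\alpha_n)=(\beta,\alpha_n)=1$, then $[e_\alpha,e_\beta]=0$ if $|\alpha|=|\beta|=1$ and $[e_\alpha,e_\beta]=e_{\alpha+\beta}$ otherwise. (Cases (1) and (2) are extended by symmetry in $\alpha,\beta$.) These brackets make $N_1(n,k)$ and $N_2(n,k)$ Lie algebras over $k$. *)

(* Defs.v *)
From HB Require Import structures.
From mathcomp Require Import all_boot all_order all_algebra.

Set Implicit Arguments.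
Unset Strict Implicit.
Unset Printing Implicit Defensive.

Import GRing.Theory.
Local Open Scope ring_scope.

Lemma alternating_sum0 (J : finType) (W : zmodType) (F : J -> J -> W) :
    (forall i j, F i j = - F j i) -> (forall i, F i i = 0) ->
  \sum_i \sum_j F i j = 0.
Proof.
move=> FC Fii; pose lt (i j : J) := (enum_rank i < enum_rank j)%N.
transitivity (\sum_i (\sum_(j | lt j i) F i j + \sum_(j | lt i j) F i j)).
  apply: eq_bigr => i _; rewrite (bigID (fun j => lt j i)) /=.
  congr (_ + _); rewrite (bigD1 i) /lt ?ltnn //= Fii add0r.
  apply: eq_bigl => j; rewrite -leqNgt ltn_neqAle andbC eq_sym.
  by rewrite -(inj_eq enum_rank_inj).
rewrite big_split /= [X in _ + X](exchange_big_dep predT) //= -big_split /=.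
rewrite big1 // => i _; rewrite -big_split big1 //= => j _.
by rewrite FC addNr.
Qed.

HB.mixin Record Vector_isLieAlgebra (k : fieldType) V of Vector k V := {
  lbr : V -> V -> V;
  lbr_linearl : forall y : V, linear (fun x => lbr x y);
  lbr_linearr : forall x : V, linear (lbr x);
  lbrxx : forall x : V, lbr x x = 0;
  lbr_jacobi : forall x y z : V,
    lbr x (lbr y z) + lbr y (lbr z x) + lbr z (lbr x y) = 0
}.

#[short(type="lieAlgType")]
HB.structure Definition LieAlgebra (k : fieldType) :=
  { V of Vector k V & Vector_isLieAlgebra k V }.

Section LieTheory.
Variables (k : fieldType) (V : lieAlgType k).
Implicit Types (x y z : V) (I : {vspace V}).

Lemma lbrDl x y z : lbr (x + y) z = lbr x z + lbr y z.
Proof. by have := lbr_linearl z 1 x y; rewrite !scale1r. Qed.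

Lemma lbrDr x y z : lbr x (y + z) = lbr x y + lbr x z.
Proof. by have := lbr_linearr x 1 y z; rewrite !scale1r. Qed.

Lemma lbr0l z : lbr 0 z = 0.
Proof. by have := lbr_linearl z (-1) 0 0; rewrite scaler0 addr0 scaleN1r addNr. Qed.

Lemma lbr0r z : lbr z 0 = 0.
Proof. by have := lbr_linearr z (-1) 0 0; rewrite scaler0 addr0 scaleN1r addNr. Qed.

Lemma lbrZl a x z : lbr (a *: x) z = a *: lbr x z.
Proof. by have := lbr_linearl z a x 0; rewrite lbr0l !addr0. Qed.

Lemma lbrZr a x z : lbr z (a *: x) = a *: lbr z x.
Proof. by have := lbr_linearr z a x 0; rewrite lbr0r !addr0. Qed.

Lemma lbr_suml J (r : seq J) (P : pred J) (F : J -> V) z :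
  lbr (\sum_(i <- r | P i) F i) z = \sum_(i <- r | P i) lbr (F i) z.
Proof.
exact: (big_morph (fun x => lbr x z) (fun x y => lbrDl x y z) (lbr0l z)).
Qed.

Lemma lbr_sumr J (r : seq J) (P : pred J) (F : J -> V) z :
  lbr z (\sum_(i <- r | P i) F i) = \sum_(i <- r | P i) lbr z (F i).
Proof. exact: (big_morph (lbr z) (lbrDr z) (lbr0r z)). Qed.

Lemma lbrC x y : lbr x y = - lbr y x.
Proof.
apply/eqP; rewrite -addr_eq0; apply/eqP.
have := lbrxx (x + y).
by rewrite lbrDl !lbrDr !lbrxx add0r addr0.
Qed.

(* By [lbrC], left ideals are two-sided. *)
Definition lie_ideal I : Prop := forall x y, y \in I -> lbr x y \in I.

Definition lie_simple : Prop :=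
  forall I, lie_ideal I -> I = 0%VS \/ I = fullv.

(* Since the bracket is bilinear, the brackets of the vectors of a basis have
   the same span as the brackets of all elements; see [derivedP]. *)
Definition derived : {vspace V} :=
  <<[seq lbr x y | x <- vbasis {:V}, y <- vbasis {:V}]>>%VS.

Lemma lbr_derived x y : lbr x y \in derived.
Proof.
rewrite (coord_vbasis (memvf x)) (coord_vbasis (memvf y)) lbr_suml.
apply: memv_suml => i _; rewrite lbr_sumr; apply: memv_suml => j _.
rewrite lbrZl lbrZr !memvZ //; apply: memv_span.
by apply: allpairs_f; rewrite mem_nth ?size_tuple.
Qed.

Lemma derivedP v :
  v \in derived <->
  exists s : seq (k * (V * V)), v = \sum_(t <- s) t.1 *: lbr t.2.1 t.2.2.
Proof.
split=> [|[s ->]]; last first.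
  by apply: memv_suml => t _; rewrite memvZ ?lbr_derived.
rewrite /derived; set X := (X in <<X>>%VS) => /(@coord_span _ _ _ (in_tuple X)) Dv.
have brX i : exists p : V * V, (in_tuple X)`_i = lbr p.1 p.2.
  have [ltiX | leXi] := ltnP i (size X); last first.
    by exists (0, 0); rewrite nth_default //= lbr0l.
  have /allpairsP[p [_ _ Dp]] : X`_i \in X by rewrite mem_nth.
  by exists p.
rewrite {1}Dv; elim/big_ind: _ => [|u1 u2 [s1 ->] [s2 ->]|i _].
- by exists [::]; rewrite big_nil.
- by exists (s1 ++ s2); rewrite big_cat.
have [p ->] := brX i; exists [:: (coord (in_tuple X) i v, p)].
by rewrite big_seq1.
Qed.

End LieTheory.

Arguments lie_simple {k} V.
Arguments derived {k} V.

Definition derived_alg (k : fieldType) (V : lieAlgType k) : Type :=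
  subvs_of (derived V).

Section DerivedAlgebra.
Variables (k : fieldType) (V : lieAlgType k).
HB.instance Definition _ := Vector.on (derived_alg V).
Implicit Types x y z : derived_alg V.

Definition derived_lbr x y : derived_alg V :=
  Subvs (lbr_derived (vsval x) (vsval y)).

Fact derived_lbr_linearl y : linear (fun x => derived_lbr x y).
Proof.
by move=> a x z; apply: val_inj; apply: (lbr_linearl (vsval y) a (vsval x)).
Qed.

Fact derived_lbr_linearr x : linear (derived_lbr x).
Proof.
by move=> a y z; apply: val_inj; apply: (lbr_linearr (vsval x) a (vsval y)).
Qed.

Fact derived_lbrxx x : derived_lbr x x = 0.
Proof. by apply: val_inj; rewrite /= lbrxx. Qed.

Fact derived_lbr_jacobi x y z :
  derived_lbr x (derived_lbr y z) + derived_lbr y (derived_lbr z x)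
    + derived_lbr z (derived_lbr x y) = 0.
Proof. by apply: val_inj; rewrite /= lbr_jacobi. Qed.

HB.instance Definition _ := Vector_isLieAlgebra.Build k (derived_alg V)
  derived_lbr_linearl derived_lbr_linearr derived_lbrxx derived_lbr_jacobi.

End DerivedAlgebra.

(* The scalar extension of M along iota : k -> K, i.e. M (x)_k K, realised on
   coordinate vectors in the basis [vbasis {:M}], with the structure constants
   of M; [scalar_ext_univ] is the universal property of M (x)_k K. *)

Definition scalar_ext (k K : fieldType) (iota : {rmorphism k -> K})
  (M : lieAlgType k) : Type := 'rV[K]_(\dim {:M}).

Section ScalarExt.
Variables (k K : fieldType) (iota : {rmorphism k -> K}) (M : lieAlgType k).
Local Notation MK := (scalar_ext iota M).
HB.instance Definition _ := Vector.on MK.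

Definition scalar_ext_in (x : M) : MK := \row_i iota (coord (vbasis {:M}) i x).

Local Notation b i := ((vbasis {:M})`_i).

Definition scalar_ext_lbr (u v : MK) : MK :=
  \sum_i \sum_j (u 0 i * v 0 j) *: scalar_ext_in (lbr (b i) (b j)).

Fact scalar_ext_in_semilinear a x y :
  scalar_ext_in (a *: x + y) = iota a *: scalar_ext_in x + scalar_ext_in y.
Proof. by apply/rowP => i; rewrite !mxE linearP rmorphD rmorphM. Qed.

Fact scalar_ext_inD x y :
  scalar_ext_in (x + y) = scalar_ext_in x + scalar_ext_in y.
Proof. by apply/rowP => i; rewrite !mxE linearD rmorphD. Qed.

Fact scalar_ext_inZ a x : scalar_ext_in (a *: x) = iota a *: scalar_ext_in x.
Proof. by apply/rowP => i; rewrite !mxE linearZ rmorphM. Qed.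

Fact scalar_ext_in0 : scalar_ext_in 0 = 0.
Proof. by apply/rowP => i; rewrite !mxE linear0 rmorph0. Qed.

Fact scalar_ext_in_sum I (r : seq I) (P : pred I) (F : I -> M) :
  scalar_ext_in (\sum_(i <- r | P i) F i)
    = \sum_(i <- r | P i) scalar_ext_in (F i).
Proof. exact: (big_morph _ scalar_ext_inD scalar_ext_in0). Qed.

Fact scalar_ext_in_basis (i : 'I_(\dim {:M})) :
  scalar_ext_in (b i) = delta_mx 0 i.
Proof.
apply/rowP => j; rewrite !mxE coord_free ?(basis_free (vbasisP _)) //=.
by rewrite rmorph_nat eq_sym.
Qed.

Fact scalar_ext_gen (u : MK) : u = \sum_i u 0 i *: scalar_ext_in (b i).
Proof.
by rewrite {1}[u]row_sum_delta; apply: eq_bigr => i _; rewrite scalar_ext_in_basis.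
Qed.

Fact basis_gen (x : M) : x = \sum_i coord (vbasis {:M}) i x *: b i.
Proof. exact: coord_vbasis (memvf x). Qed.

Fact scalar_ext_lbr_linearl v : linear (fun u => scalar_ext_lbr u v).
Proof.
move=> a u w; rewrite /scalar_ext_lbr scaler_sumr -big_split /=.
apply: eq_bigr => i _; rewrite scaler_sumr -big_split /=.
by apply: eq_bigr => j _; rewrite !mxE scalerA -scalerDl mulrDl !mulrA.
Qed.

Fact scalar_ext_lbr_linearr u : linear (scalar_ext_lbr u).
Proof.
move=> a v w; rewrite /scalar_ext_lbr scaler_sumr -big_split /=.
apply: eq_bigr => i _; rewrite scaler_sumr -big_split /=.
by apply: eq_bigr => j _; rewrite !mxE scalerA -scalerDl mulrDr mulrCA.
Qed.

Fact scalar_ext_in_lbr x y :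
  scalar_ext_in (lbr x y) = scalar_ext_lbr (scalar_ext_in x) (scalar_ext_in y).
Proof.
rewrite {1}[x]basis_gen {1}[y]basis_gen lbr_suml scalar_ext_in_sum.
apply: eq_bigr => i _; rewrite lbr_sumr scalar_ext_in_sum.
apply: eq_bigr => j _; rewrite lbrZl lbrZr !scalar_ext_inZ scalerA.
by rewrite !mxE.
Qed.

Fact scalar_ext_lbrxx u : scalar_ext_lbr u u = 0.
Proof.
apply: alternating_sum0 => [i j|i].
  rewrite lbrC -scaleN1r scalar_ext_inZ rmorphN1 scaleN1r scalerN.
  by rewrite [u 0 i * _]mulrC.
by rewrite lbrxx scalar_ext_in0 scaler0.
Qed.

Fact scalar_ext_lbr_jacobi u v w :
  scalar_ext_lbr u (scalar_ext_lbr v w) + scalar_ext_lbr v (scalar_ext_lbr w u)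
    + scalar_ext_lbr w (scalar_ext_lbr u v) = 0.
Proof.
pose lL v := GRing.isLinear.Build K MK MK _ _ (scalar_ext_lbr_linearl v).
pose lR u := GRing.isLinear.Build K MK MK _ _ (scalar_ext_lbr_linearr u).
pose Ll v : {linear MK -> MK} := HB.pack (fun u => scalar_ext_lbr u v) (lL v).
pose Lr u : {linear MK -> MK} := HB.pack (scalar_ext_lbr u) (lR u).
have suml (G : 'I__ -> MK) (c : 'I__ -> K) z :
  scalar_ext_lbr (\sum_i c i *: G i) z = \sum_i c i *: scalar_ext_lbr (G i) z.
  rewrite -[LHS]/(Ll z _) linear_sum; apply: eq_bigr => i _; exact: linearZ.
have sumr (G : 'I__ -> MK) (c : 'I__ -> K) z :
  scalar_ext_lbr z (\sum_i c i *: G i) = \sum_i c i *: scalar_ext_lbr z (G i).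
  rewrite -[LHS]/(Lr z _) linear_sum; apply: eq_bigr => i _; exact: linearZ.
rewrite [u]scalar_ext_gen !(suml, sumr) -!big_split big1 //= => i _.
rewrite -!scalerDr [X in _ *: X](_ : _ = 0) ?scaler0 //.
rewrite [v]scalar_ext_gen !(suml, sumr) -!big_split big1 //= => j _.
rewrite -!scalerDr [X in _ *: X](_ : _ = 0) ?scaler0 //.
rewrite [w]scalar_ext_gen !(suml, sumr) -!big_split big1 //= => l _.
rewrite -!scalerDr [X in _ *: X](_ : _ = 0) ?scaler0 //.
by rewrite -!scalar_ext_in_lbr -!scalar_ext_inD lbr_jacobi scalar_ext_in0.
Qed.

HB.instance Definition _ := Vector_isLieAlgebra.Build K MK
  scalar_ext_lbr_linearl scalar_ext_lbr_linearr
  scalar_ext_lbrxx scalar_ext_lbr_jacobi.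

Lemma scalar_ext_univ (W : lmodType K) (g : M -> W) :
    (forall a x y, g (a *: x + y) = iota a *: g x + g y) ->
  exists h : {linear MK -> W},
    (forall x, h (scalar_ext_in x) = g x) /\
    (forall h' : {linear MK -> W},
       (forall x, h' (scalar_ext_in x) = g x) -> h' =1 h).
Proof.
move=> gP.
have gD x y : g (x + y) = g x + g y.
  by have := gP 1 x y; rewrite rmorph1 !scale1r.
have g0 : g 0 = 0 by apply: (addIr (g 0)); rewrite -gD !add0r.
have gZ a x : g (a *: x) = iota a *: g x.
  by have := gP a x 0; rewrite g0 !addr0.
pose h0 (u : MK) := \sum_i u 0 i *: g (b i).
have h0lin : linear h0.
  move=> a u v; rewrite /h0 scaler_sumr -big_split; apply: eq_bigr => i _ /=.
  by rewrite !mxE scalerDl scalerA.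
pose hL := GRing.isLinear.Build K MK W _ h0 h0lin.
pose h : {linear MK -> W} := HB.pack h0 hL.
exists h; split=> [x | h' Dh' u].
  rewrite [in RHS](basis_gen x) (big_morph _ gD g0).
  by apply: eq_bigr => i _; rewrite gZ !mxE.
rewrite {1}[u]scalar_ext_gen linear_sum; apply: eq_bigr => i _.
by rewrite linearZ /= Dh'.
Qed.

End ScalarExt.

Definition absolutely_simple (k : fieldType) (M : lieAlgType k) : Prop :=
  forall (K : fieldType) (iota : {rmorphism k -> K}),
    lie_simple (scalar_ext iota M).

Section RootData.
Variable n : nat.
Implicit Types a b : 'rV['F_2]_n.

Definition dot a b : 'F_2 := \sum_(i < n) a 0 i * b 0 i.

Definition parity a : 'F_2 := \sum_(i < n) a 0 i.

Definition alpha_last : 'rV['F_2]_n := \row_(i < n) (i.+1 == n)%:R.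

(* [Ni_rule a b] states that, for distinct a and b in Phi, the bracket
   [e_a, e_b] in N_i(n,k) is e_(a+b) rather than 0. A parity or a product that
   is not 1 is 0. *)
Definition N1_rule a b : bool :=
  if (parity a == 1) && (parity b == 1) then true else dot a b == 1.

Definition N2_rule a b : bool :=
  if (dot a alpha_last == 1) && (dot b alpha_last == 1)
  then ~~ ((parity a == 1) && (parity b == 1))
  else if (parity a == 1) && (parity b == 1) then true else dot a b == 1.

Lemma dotC a b : dot a b = dot b a.
Proof. by apply: eq_bigr => i _; rewrite mulrC. Qed.

Lemma dotDl a b c : dot (a + b) c = dot a c + dot b c.
Proof. by rewrite -big_split; apply: eq_bigr => i _; rewrite mxE mulrDl. Qed.

Lemma dotDr a b c : dot c (a + b) = dot c a + dot c b.
Proof. by rewrite ![dot c _]dotC dotDl. Qed.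

Lemma parityD a b : parity (a + b) = parity a + parity b.
Proof. by rewrite -big_split; apply: eq_bigr => i _; rewrite mxE. Qed.

Lemma dot0l a : dot 0 a = 0.
Proof. by rewrite /dot big1 // => i _; rewrite mxE mul0r. Qed.

Lemma parity0 : parity 0 = 0.
Proof. by rewrite /parity big1 // => i _; rewrite mxE. Qed.

Lemma F2_addE (x y : 'F_2) : (x + y == 1) = (x == 1) (+) (y == 1).
Proof. by case: x => [[|[|[]]] ?]; case: y => [[|[|[]]] ?]. Qed.

Definition lie_rule (rule : rel 'rV['F_2]_n) : Prop :=
  [/\ forall a b, rule a b = rule b a,
      forall a, rule 0 a = false &
      forall a b c, (rule b c && rule a (b + c)) (+) (rule c a && rule b (c + a))
        (+) (rule a b && rule c (a + b)) = false].

Lemma N1_lie_rule : lie_rule N1_rule.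
Proof.
split=> [a b|a|a b c]; rewrite /N1_rule.
- by rewrite dotC andbC.
- by rewrite parity0 dot0l.
rewrite !(parityD, dotDr, F2_addE) (dotC c a) (dotC c b) (dotC b a).
by do 6![case: (_ == 1)].
Qed.

Lemma N2_lie_rule : lie_rule N2_rule.
Proof.
split=> [a b|a|a b c]; rewrite /N2_rule.
- by rewrite (dotC a b) [_ && (parity b == 1)]andbC [_ && (dot b _ == 1)]andbC.
- by rewrite parity0 !dot0l.
rewrite !(parityD, dotDl, dotDr, F2_addE) (dotC c a) (dotC c b) (dotC b a).
by do 9![case: (_ == 1)].
Qed.

End RootData.

Definition Phi (n : nat) : finType := {a : 'rV['F_2]_n | a != 0}.

Section BracketOfRule.
Variables (n : nat) (k : fieldType).
Local Notation V := {ffun Phi n -> k^o}.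

(* For a in Phi, the basis vector e_a; moreover [ebase 0] is 0. *)
Definition ebase (a : 'rV['F_2]_n) : V := [ffun c => (val c == a)%:R].

Variable rule : rel 'rV['F_2]_n.

Definition ebase_br (a b : 'rV['F_2]_n) : V :=
  if (a != b) && rule a b then ebase (a + b) else 0.

Definition rule_br (x y : V) : V :=
  \sum_(a : Phi n) \sum_(b : Phi n) (x a * y b : k) *: ebase_br (val a) (val b).

Lemma ebase0 : ebase 0 = 0.
Proof. by apply/ffunP => c; rewrite !ffunE (negPf (valP c)). Qed.

Lemma ebase_gen (x : V) : x = \sum_(a : Phi n) x a *: ebase (val a).
Proof.
apply/ffunP => c; rewrite sum_ffunE (bigD1 c) //= big1 ?addr0 => [|a ne_ac].
  by rewrite !ffunE eqxx [_ *: _]mulr1.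
by rewrite !ffunE (inj_eq val_inj) eq_sym (negPf ne_ac) [_ *: _]mulr0.
Qed.

Fact rule_br_linearl y : linear (fun x => rule_br x y).
Proof.
move=> t x z; rewrite /rule_br scaler_sumr -big_split /=.
apply: eq_bigr => i _; rewrite scaler_sumr -big_split /=.
apply: eq_bigr => j _; rewrite !ffunE scalerA -scalerDl mulrDl.
by rewrite -[t *: _]/(t * _) mulrA.
Qed.

Fact rule_br_linearr x : linear (rule_br x).
Proof.
move=> t y z; rewrite /rule_br scaler_sumr -big_split /=.
apply: eq_bigr => i _; rewrite scaler_sumr -big_split /=.
apply: eq_bigr => j _; rewrite !ffunE scalerA -scalerDl mulrDr.
by rewrite -[t *: _]/(t * _) mulrCA.
Qed.

Lemma rule_br_ebase (a b : Phi n) :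
  rule_br (ebase (val a)) (ebase (val b)) = ebase_br (val a) (val b).
Proof.
rewrite /rule_br (bigD1 a) //= [X in _ + X]big1 ?addr0 => [|c ne_ca].
  rewrite (bigD1 b) //= big1 ?addr0 => [|d ne_db].
    by rewrite !ffunE !eqxx mulr1 scale1r.
  by rewrite !ffunE (inj_eq val_inj d) (negPf ne_db) mulr0 scale0r.
rewrite big1 // => d _.
by rewrite !ffunE (inj_eq val_inj c) (negPf ne_ca) mul0r scale0r.
Qed.

Hypotheses (pchar2 : 2%N \in [pchar k]) (ruleP : lie_rule rule).

Let F2_addxx (a : 'rV['F_2]_n) : a + a = 0.
Proof.
by apply/rowP => i; rewrite !mxE; case: (a 0 i) => [[|[|[]]] ?] //; apply: val_inj.
Qed.

Let oppk (x : k) : - x = x. Proof. exact: oppr_pchar2. Qed.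

Let oppV (x : V) : - x = x.
Proof. by rewrite -scaleN1r oppk scale1r. Qed.

Let ebase_brE a b : ebase_br a b = (rule a b)%:R *: ebase (a + b).
Proof.
rewrite /ebase_br; case: eqP => [<- | _] /=; first by rewrite F2_addxx ebase0 scaler0.
by case: (rule a b); rewrite ?scale1r ?scale0r.
Qed.

Let rule_brE a b : rule_br (ebase a) (ebase b) = ebase_br a b.
Proof.
have [ruleC rule0 _] := ruleP.
have [-> | nz_a] := eqVneq a 0.
  rewrite ebase_brE rule0 scale0r ebase0 /rule_br big1 // => c _.
  by rewrite big1 // => d _; rewrite ffunE mul0r scale0r.
have [-> | nz_b] := eqVneq b 0.
  rewrite ebase_brE ruleC rule0 scale0r ebase0 /rule_br big1 // => c _.
  by rewrite big1 // => d _; rewrite [X in _ * X]ffunE mulr0 scale0r.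
exact: (rule_br_ebase (Sub a nz_a) (Sub b nz_b)).
Qed.

Fact rule_brxx x : rule_br x x = 0.
Proof.
have [ruleC _ _] := ruleP.
apply: alternating_sum0 => [a b | a]; last by rewrite /ebase_br eqxx scaler0.
by rewrite oppV mulrC /ebase_br eq_sym ruleC [val a + _]addrC.
Qed.

Fact rule_br_jacobi x y z :
  rule_br x (rule_br y z) + rule_br y (rule_br z x) + rule_br z (rule_br x y) = 0.
Proof.
have [_ _ ruleJ] := ruleP.
pose Ll v : {linear V -> V} :=
  HB.pack (fun u => rule_br u v) (GRing.isLinear.Build k V V _ _ (rule_br_linearl v)).
pose Lr u : {linear V -> V} :=
  HB.pack (rule_br u) (GRing.isLinear.Build k V V _ _ (rule_br_linearr u)).
have suml (G : Phi n -> V) (c : Phi n -> k) t :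
  rule_br (\sum_a c a *: G a) t = \sum_a c a *: rule_br (G a) t.
  rewrite -[LHS]/(Ll t _) linear_sum; apply: eq_bigr => i _; exact: linearZ.
have sumr (G : Phi n -> V) (c : Phi n -> k) t :
  rule_br t (\sum_a c a *: G a) = \sum_a c a *: rule_br t (G a).
  rewrite -[LHS]/(Lr t _) linear_sum; apply: eq_bigr => i _; exact: linearZ.
have brZ (c : k) u v : rule_br u (c *: v) = c *: rule_br u v.
  by rewrite -[LHS]/(Lr u _) linearZ.
rewrite [x]ebase_gen !(suml, sumr) -!big_split big1 //= => a _.
rewrite -!scalerDr [X in _ *: X](_ : _ = 0) ?scaler0 //.
rewrite [y]ebase_gen !(suml, sumr) -!big_split big1 //= => b _.
rewrite -!scalerDr [X in _ *: X](_ : _ = 0) ?scaler0 //.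
rewrite [z]ebase_gen !(suml, sumr) -!big_split big1 //= => c _.
rewrite -!scalerDr [X in _ *: X](_ : _ = 0) ?scaler0 //.
move: (val a) (val b) (val c) => {}a {}b {}c.
rewrite !rule_brE !ebase_brE !brZ !rule_brE !ebase_brE !scalerA.
rewrite (_ : b + (c + a) = a + (b + c)); last by rewrite [c + a]addrC addrCA.
rewrite (_ : c + (a + b) = a + (b + c)); last by rewrite addrCA [c + b]addrC.
rewrite -!scalerDl [X in X *: _](_ : _ = 0) ?scale0r //.
have kxx : (1 + 1 : k) = 0 by rewrite -[X in _ + X]oppk subrr.
have := ruleJ a b c; rewrite -!natrM !mulnb.
by do 3![case: (_ && _)] => //= _; rewrite ?add0r ?addr0.
Qed.

End BracketOfRule.

(* The characteristic 2 hypothesis is a parameter of these types because the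
   Lie algebra axioms need it. *)
Definition N1 (n : nat) (k : fieldType) (_ : 2%N \in [pchar k]) : Type :=
  {ffun Phi n -> k^o}.

Definition N2 (n : nat) (k : fieldType) (_ : 2%N \in [pchar k]) : Type :=
  {ffun Phi n -> k^o}.

Section Instances.
Variables (n : nat) (k : fieldType) (pchar2 : 2%N \in [pchar k]).

HB.instance Definition _ := Vector.on (N1 n pchar2).
HB.instance Definition _ := Vector_isLieAlgebra.Build k (N1 n pchar2)
  (rule_br_linearl (N1_rule (n := n))) (rule_br_linearr (N1_rule (n := n)))
  (rule_brxx pchar2 (N1_lie_rule n)) (rule_br_jacobi pchar2 (N1_lie_rule n)).

HB.instance Definition _ := Vector.on (N2 n pchar2).
HB.instance Definition _ := Vector_isLieAlgebra.Build k (N2 n pchar2)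
  (rule_br_linearl (N2_rule (n := n))) (rule_br_linearr (N2_rule (n := n)))
  (rule_brxx pchar2 (N2_lie_rule n)) (rule_br_jacobi pchar2 (N2_lie_rule n)).

Lemma N1_lbr_ebase (a b : Phi n) :
  lbr (ebase k (val a) : N1 n pchar2) (ebase k (val b))
    = ebase_br k (N1_rule (n := n)) (val a) (val b).
Proof. exact: rule_br_ebase. Qed.

Lemma N2_lbr_ebase (a b : Phi n) :
  lbr (ebase k (val a) : N2 n pchar2) (ebase k (val b))
    = ebase_br k (N2_rule (n := n)) (val a) (val b).
Proof. exact: rule_br_ebase. Qed.

End Instances.

(* Main.v *)
Require Import Defs.
From HB Require Import structures.
From mathcomp Require Import all_boot all_order all_algebra.

Set Implicit Arguments.
Unset Strict Implicit.
Unset Printing Implicit Defensive.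

Import GRing.Theory.
Local Open Scope ring_scope.

(** Write 1 for the all-ones vector [ones]. As n is odd, |1| = 1, so GF(2)^n is
the orthogonal sum of the even vectors H = { h : |h| = 0 } and the line of 1, and
the inner product is a nondegenerate alternating form on H. No bracket has a
component along e_1, and e_c = [e_h, e_(h+c)] as soon as h in H satisfies
(h,c) = 1; such an h exists if c is neither 0 nor 1. So [L,L] has the basis
{ e_c : c <> 0, 1 } ([derivedE], [dim_derived]).

Simplicity rests on the identity (ad e_h)^2 e_a = (h,a) e_a for h in H, which is
the property [rule_sqr] of the bracket rule and holds for both algebras. The
commuting operators (ad e_h)^2, h in H, are thus diagonal with eigenvalues 0 and 1
over every field, and two indices a, b have the same eigenvalues exactly when a + b
is 0 or 1. An ideal is stable under these operators, so it is the sum of its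
intersections with the planes spanned by e_a and e_(a+1), a in H. Hence a nonzero
ideal contains some s e_a + t e_(a+1) with (s,t) <> (0,0) ([ideal_pair]).

For h in H with (h,a) = 1, ad e_h moves such a combination to the index h + a with
the same s and t, and these moves connect all nonzero even indices
([even_connected]). At a suitable index a single bracket kills the first term and
keeps the second one, so the ideal contains a basis vector. The same moves and
brackets between indices of different parities then give all of them
([ideal_pure]). This shows the simplicity over any field of an algebra with a
spanning family that obeys such a rule ([graded_lie_simple]). An extension of scalars
keeps the spanning family and its structure constants, which are 0 or 1. *)

(** * Binary vectors *)

Section Vectors.
Variable n : nat.
Implicit Types a b c h : 'rV['F_2]_n.

Definition ones : 'rV['F_2]_n := const_mx 1.

(** The indices of the basis of the derived algebra. *)
Definition proper_vec a := (a != 0) && (a != ones).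

Lemma F2_eq (x y : 'F_2) : (x == 1) = (y == 1) -> x = y.
Proof. by case: x => [[|[|[]]] ?]; case: y => [[|[|[]]] ?] // _; apply: val_inj. Qed.

Lemma addvv a : a + a = 0.
Proof.
by apply/rowP => i; rewrite !mxE; apply: F2_eq; rewrite F2_addE addbb.
Qed.

Lemma addKv a : involutive (+%R a).
Proof. by move=> b; rewrite addrA addvv add0r. Qed.

Lemma addv_eq a b c : (a + b == c) = (b == a + c).
Proof. by rewrite -(inj_eq (inv_inj (addKv a))) addKv. Qed.

Lemma dotv1 a : dot a ones = parity a.
Proof. by apply: eq_bigr => i _; rewrite mxE mulr1. Qed.

Lemma dotvv a : dot a a = parity a.
Proof.
by apply: eq_bigr => i _; apply: F2_eq; case: (a 0 i) => [[|[|[]]] ?].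
Qed.

Definition unitv i : 'rV['F_2]_n := delta_mx 0 i.

Lemma unitvE i j : unitv i 0 j = (j == i)%:R.
Proof. by rewrite mxE eqxx. Qed.

Lemma dot_unitv i a : dot (unitv i) a = a 0 i.
Proof.
rewrite /dot (bigD1 i) //= unitvE eqxx mul1r big1 ?addr0 // => j /negPf ne_ji.
by rewrite unitvE ne_ji mul0r.
Qed.

Lemma parity_unitv i : parity (unitv i) = 1.
Proof. by rewrite -dotv1 dot_unitv mxE. Qed.

Lemma dot_even_ones h a : parity h != 1 -> dot h (a + ones) = dot h a.
Proof.
by move=> ev_h; apply: F2_eq; rewrite dotDr F2_addE dotv1 (negPf ev_h) addbF.
Qed.

(** The orthogonal of the even vectors is {0, ones}: if a has an entry 1 at i and
an entry 0 at j, then the sum of the i-th and j-th unit vectors works. *)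
Lemma even_detects a : proper_vec a -> exists2 h, parity h != 1 & dot h a == 1.
Proof.
case/andP=> nz_a n1_a.
have [i ai] : exists i, a 0 i == 1.
  apply/existsP; apply: contraR nz_a; rewrite negb_exists => /forallP a0.
  by apply/eqP/rowP => i; rewrite mxE; apply: F2_eq; rewrite (negPf (a0 i)).
have [j aj] : exists j, a 0 j != 1.
  apply/existsP; apply: contraR n1_a; rewrite negb_exists => /forallP a1.
  by apply/eqP/rowP => i0; rewrite mxE; apply/eqP; have := a1 i0; rewrite negbK.
exists (unitv i + unitv j).
  by rewrite parityD F2_addE !parity_unitv eqxx.
by rewrite dotDl F2_addE !dot_unitv ai (negPf aj).
Qed.

(** The even vectors orthogonal to a and those orthogonal to b form two proper
subgroups, and a group is not the union of two proper subgroups. *)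
Lemma even_detects2 a b : proper_vec a -> proper_vec b ->
  exists h, [/\ parity h != 1, dot h a == 1 & dot h b == 1].
Proof.
case/even_detects=> h ev_h ha1 /even_detects[g ev_g gb1].
have [hb1 | hb0] := boolP (dot h b == 1); first by exists h.
have [ga1 | ga0] := boolP (dot g a == 1); first by exists g.
exists (h + g); rewrite parityD !dotDl !F2_addE.
by rewrite ha1 gb1 (negPf hb0) (negPf ga0) (negPf ev_h) (negPf ev_g).
Qed.

(** Any two proper vectors of the same parity are joined by at most two moves
c |-> h + c with h even and (h,c) = 1. The move by a + b goes from a to b unless
(a+b,a) = 0; in that case an even h with (h,a) = (h,b) = 1 gives the moves by h and
then by h + a + b. *)
Lemma even_connected (S : 'rV['F_2]_n -> Prop) a b :
    (forall h c, parity h != 1 -> dot h c == 1 -> S c -> S (h + c)) ->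
    proper_vec a -> proper_vec b -> parity a = parity b ->
  S a -> S b.
Proof.
move=> Sstep pr_a pr_b eq_ab Sa.
have ev_ab : parity (a + b) != 1 by rewrite parityD eq_ab F2_addE addbb.
have step1 : dot (a + b) a == 1 -> S b.
  by move=> ab_a; rewrite -[b](addKv a) addrC; apply: Sstep.
have [/step1 // | ab_a] := boolP (dot (a + b) a == 1).
have [h [ev_h ha hb]] := even_detects2 pr_a pr_b.
have ev_hab : parity (h + (a + b)) != 1.
  by rewrite parityD F2_addE (negPf ev_h) (negPf ev_ab).
have Sha := Sstep _ _ ev_h ha Sa.
have := Sstep _ _ ev_hab _ Sha.
rewrite (_ : h + (a + b) + (h + a) = b); last first.
  by rewrite addrACA addvv add0r addrC addKv.
apply; move: ab_a ha.
rewrite !dotDl !dotDr !F2_addE !dotvv (dotC b h) (dotC a h) hb => + ->.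
rewrite (negPf ev_h) (dotC b a) eq_ab.
by case: (parity b == 1); case: (dot a b == 1).
Qed.

(** * Bracket rules that force simplicity *)

(** What the two algebras have in common. By [rule_sqr], the squares of the ad e_h
with h even are diagonal, with eigenvalues (h,a); by [rule_ones], e_ones is not in
the derived algebra. The witness b of [rule_pure] separates e_h from e_(h+ones),
and those of [rule_odd] lead from odd indices to even ones. *)
Record splitting_rule (rule : rel 'rV['F_2]_n) : Prop := SplittingRule {
  rule_sqr : forall h a,
    parity h != 1 -> rule h a && rule h (h + a) = (dot h a == 1);
  rule_ones : forall a, rule a (a + ones) = false;
  rule_pure : exists h b, [/\ parity h != 1, proper_vec h, proper_vec b,
    proper_vec (b + h) & ~~ rule b h && rule b (h + ones)];
  rule_odd : exists a b, [/\ parity a = 1, parity b = 1, proper_vec a,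
    proper_vec b & proper_vec (a + b) && rule a b]
}.

Lemma rule_dot rule h a : splitting_rule rule ->
  parity h != 1 -> dot h a == 1 -> rule h a.
Proof.
move=> ruleP ev_h ha.
by have /andP[] : rule h a && rule h (h + a) by rewrite rule_sqr.
Qed.

Lemma dot_proper h a : parity h != 1 -> dot h a == 1 -> proper_vec a.
Proof.
move=> ev_h ha; apply/andP; split; apply: contraTneq ha => ->.
  by rewrite dotC dot0l.
by rewrite dotv1.
Qed.

Hypothesis odd_ones : parity ones = 1.

Lemma dot_properl h a : parity h != 1 -> dot h a == 1 -> proper_vec h.
Proof.
move=> ev_h ha; apply/andP; split; apply: contraTneq ha => eq_h.
  by rewrite eq_h dot0l.
by rewrite eq_h odd_ones in ev_h.
Qed.

Lemma dot_step h a : parity h != 1 -> dot h a == 1 -> dot h (h + a) == 1.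
Proof. by move=> ev_h ha; rewrite dotDr F2_addE dotvv ha (negPf ev_h). Qed.

Lemma ones_neq0 : ones != 0.
Proof. by apply/eqP=> ones0; move: odd_ones; rewrite ones0 parity0. Qed.

Lemma proper_addones a : proper_vec (a + ones) = proper_vec a.
Proof.
by rewrite /proper_vec addrC !addv_eq addvv addr0 andbC.
Qed.

(** * Ideals of an algebra spanned by vectors indexed by GF(2)^n *)

Section GradedSimple.
Variables (K : fieldType) (W : lieAlgType K) (E : 'rV['F_2]_n -> W).
Variable rule : rel 'rV['F_2]_n.
Hypothesis ruleP : splitting_rule rule.
Hypotheses (E0 : E 0 = 0) (E1 : E ones = 0).
Hypothesis spanE : fullv = (\sum_c <[E c]>)%VS.
Hypothesis lbrE : forall a b, proper_vec a -> proper_vec b ->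
  lbr (E a) (E b) = (rule a b)%:R *: E (a + b).

Lemma E_improper a : ~~ proper_vec a -> E a = 0.
Proof. by rewrite /proper_vec negb_and !negbK => /orP[] /eqP ->. Qed.

(** When h + a is 0 or [ones], both sides vanish, since then (h,a) = 0. *)
Lemma ad_sqr h a : parity h != 1 ->
  lbr (E h) (lbr (E h) (E a)) = (dot h a == 1)%:R *: E a.
Proof.
move=> ev_h.
have [ha | not_ha] := boolP (dot h a == 1).
  have [pr_h pr_a] := (dot_properl ev_h ha, dot_proper ev_h ha).
  have pr_ha := dot_proper ev_h (dot_step ev_h ha).
  rewrite lbrE // lbrZr lbrE // addKv !(rule_dot ruleP ev_h) ?dot_step //.
  by rewrite !scale1r.
rewrite scale0r.
have [pr_h | /E_improper ->] := boolP (proper_vec h); last by rewrite lbr0l.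
have [pr_a | /E_improper ->] := boolP (proper_vec a); last by rewrite !lbr0r.
rewrite lbrE // lbrZr.
have [pr_ha | /E_improper ->] := boolP (proper_vec (h + a)); last first.
  by rewrite lbr0r scaler0.
by rewrite lbrE // scalerA -natrM mulnb rule_sqr // (negPf not_ha) scale0r.
Qed.

Lemma ad_sqr_line h a v : parity h != 1 -> v \in <[E a]>%VS ->
  lbr (E h) (lbr (E h) v) = (dot h a == 1)%:R *: v.
Proof.
by move=> ev_h /vlineP[x ->]; rewrite !lbrZr ad_sqr // !scalerA mulrC.
Qed.

Variable I : {vspace W}.
Hypothesis idealI : lie_ideal I.

(** For each h in s, either (ad e_h)^2 or 1 - (ad e_h)^2 is the projection onto
the components c with (h,c) = (h,a), and both preserve the ideal. *)
Lemma ideal_filter (us : 'rV['F_2]_n -> W) a (s : seq 'rV['F_2]_n) :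
    (forall c, us c \in <[E c]>%VS) -> \sum_c us c \in I ->
    all (fun h => parity h != 1) s ->
  \sum_(c | all (fun h => (dot h c == 1) == (dot h a == 1)) s) us c \in I.
Proof.
move=> usE uI; elim: s => [|h s IHs] //= /andP[ev_h /IHs{IHs}].
pose P c := all (fun h => (dot h c == 1) == (dot h a == 1)) s.
rewrite -/(P _); set v := \sum_(c | _) us c => vI.
have sq_v : lbr (E h) (lbr (E h) v) = \sum_(c | P c && (dot h c == 1)) us c.
  rewrite !lbr_sumr big_mkcondr; apply: eq_bigr => c _.
  by rewrite (ad_sqr_line ev_h (usE c)); case: ifP; rewrite ?scale1r ?scale0r.
have sqI : \sum_(c | P c && (dot h c == 1)) us c \in I.
  by rewrite -sq_v !idealI.
have [ha | ha] := boolP (dot h a == 1).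
  by under eq_bigl do rewrite eqb_id andbC.
under eq_bigl do rewrite eqbF_neg andbC.
set w := \sum_(c | P c && (dot h c == 1)) us c in sqI.
have Dv : v = w + \sum_(c | P c && (dot h c != 1)) us c.
  by rewrite /v (bigID (fun c => dot h c == 1)).
by rewrite -[X in X \in _](addKr w) -Dv memvD ?memvN.
Qed.

(** Filtering by all even vectors leaves the components at a and a + ones. The one
with the even index is written first, whence the exchange of s and t when a is
odd. *)
Lemma ideal_pair : I != 0%VS ->
  exists a s t, [/\ parity a != 1, proper_vec a, (s != 0) || (t != 0) &
    s *: E a + t *: E (a + ones) \in I].
Proof.
rewrite -subv0 => /subvPn[u uI nz_u].
have [us usE Du] : exists2 us, (forall c, us c \in <[E c]>%VS) & u = \sum_c us c.
  have /memv_sumP[us usE ->] : u \in (\sum_c <[E c]>)%VS by rewrite -spanE memvf.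
  by exists us => // c; apply: usE.
have [a nz_ua] : exists a, us a != 0.
  apply/existsP; apply: contraR nz_u; rewrite negb_exists => /forallP us0.
  by rewrite memv0 Du big1 // => c _; apply/eqP; rewrite -[_ == _]negbK us0.
have pr_a : proper_vec a.
  apply: contraR nz_ua => /E_improper Ea0.
  by have := usE a; rewrite Ea0 => /vlineP[x ->]; rewrite scaler0.
have ua1I : us a + us (a + ones) \in I.
  have evs : all (fun h => parity h != 1) (enum [pred h | parity h != 1]).
    by apply/allP=> h; rewrite mem_enum.
  have:= @ideal_filter us a _ usE _ evs; rewrite -Du => /(_ uI).
  rewrite (bigD1 a) /=; last by apply/allP.
  rewrite (big_pred1 (a + ones)) // => c /=.
  have ne_a1 : a + ones != a by rewrite addv_eq addvv ones_neq0.
  apply/andP/eqP=> [[/allP ac ne_ca] | ->]; last first.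
    split=> //; apply/allP=> h; rewrite mem_enum => ev_h.
    by rewrite dot_even_ones.
  have im_ac : ~~ proper_vec (a + c).
    apply/negP=> /even_detects[h ev_h].
    have /ac/eqP ahc : h \in enum [pred h | parity h != 1] by rewrite mem_enum.
    by rewrite dotDr F2_addE ahc addbb.
  move: im_ac; rewrite negb_and !negbK !addv_eq addr0 (negPf ne_ca).
  by move/eqP.
have /vlineP[x Dx] := usE a; have /vlineP[y Dy] := usE (a + ones).
have nz_x : x != 0 by apply: contraNneq nz_ua => x0; rewrite Dx x0 scale0r.
rewrite Dx Dy in ua1I.
have [odd_a | ev_a] := boolP (parity a == 1); last first.
  by exists a, x, y; rewrite nz_x.
exists (a + ones), y, x; rewrite parityD F2_addE odd_ones odd_a proper_addones.
by rewrite eqxx nz_x orbT -addrA addvv addr0 [X in X \in I]addrC.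
Qed.

(** The even vector h has the same product with a and a + ones, so ad e_h moves
both terms at once and keeps their coefficients. *)
Lemma ideal_step s t h a :
    parity h != 1 -> dot h a == 1 ->
  s *: E a + t *: E (a + ones) \in I ->
  s *: E (h + a) + t *: E (h + a + ones) \in I.
Proof.
move=> ev_h ha /(idealI (E h)).
have ha1 : dot h (a + ones) == 1 by rewrite dot_even_ones.
have [pr_h pr_a] := (dot_properl ev_h ha, dot_proper ev_h ha).
rewrite lbrDr !lbrZr !lbrE ?proper_addones //.
by rewrite !(rule_dot ruleP ev_h) // !scale1r [h + (a + _)]addrA.
Qed.

Lemma ideal_same_parity a b : proper_vec a -> proper_vec b ->
  parity a = parity b -> E a \in I -> E b \in I.
Proof.
move=> pr_a pr_b eq_ab.
apply: (even_connected (S := fun c => E c \in I)) pr_a pr_b eq_ab => h c ev_h hc cI.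
have := @ideal_step 1 0 h c ev_h hc.
by rewrite !scale1r !scale0r !addr0 => /(_ cI).
Qed.

Lemma ideal_mono a b : proper_vec a -> proper_vec b -> rule a b ->
  E b \in I -> E (a + b) \in I.
Proof.
by move=> pr_a pr_b ab /(idealI (E a)); rewrite lbrE // ab scale1r.
Qed.

Lemma ideal_mono_l a b : proper_vec a -> proper_vec b -> rule a b ->
  E a \in I -> E (a + b) \in I.
Proof.
move=> pr_a pr_b ab /(idealI (E b)).
by rewrite lbrC memvN lbrE // ab scale1r.
Qed.

(** From an odd index, [rule_odd] leads to an even one. From an even index one
reaches every even h, and then every odd c as e_c = [e_h, e_(h+c)] for an even h
with (h,c) = 1. *)
Lemma ideal_pure a : proper_vec a -> E a \in I -> I = fullv.
Proof.
have even_all b : proper_vec b -> parity b != 1 -> E b \in I ->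
    forall c, proper_vec c -> E c \in I.
  move=> pr_b ev_b bI c pr_c; have [h ev_h hc] := even_detects pr_c.
  have pr_h := dot_properl ev_h hc.
  have hI : E h \in I.
    apply: ideal_same_parity pr_b pr_h _ bI.
    by apply: F2_eq; rewrite (negPf ev_b) (negPf ev_h).
  have h_hc := dot_step ev_h hc; have pr_hc := dot_proper ev_h h_hc.
  rewrite -[c](addKv h); apply: ideal_mono_l => //.
  exact: rule_dot ruleP ev_h h_hc.
suff all_in b : proper_vec b -> E b \in I -> forall c, proper_vec c -> E c \in I.
  move=> pr_a aI; apply/eqP; rewrite eqEsubv subvf spanE; apply/subv_sumP=> c _.
  rewrite -memvE; have [|/E_improper->] := boolP (proper_vec c); last exact: mem0v.
  exact: all_in pr_a aI c.
move=> pr_b; have [odd_b bI | ev_b] := boolP (parity b == 1); last exact: even_all.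
have [a1 [b1 [odd_a1 odd_b1 pr_a1 pr_b1 /andP[pr_ab ab]]]] := rule_odd ruleP.
apply: (even_all _ pr_ab); first by rewrite parityD F2_addE odd_a1 odd_b1.
apply: ideal_mono => //; apply: ideal_same_parity pr_b pr_b1 _ bI.
by rewrite odd_b1; apply/eqP.
Qed.

End GradedSimple.

Lemma graded_lie_simple (K : fieldType) (W : lieAlgType K)
    (E : 'rV['F_2]_n -> W) (rule : rel 'rV['F_2]_n) :
    splitting_rule rule -> E 0 = 0 -> E ones = 0 ->
    fullv = (\sum_c <[E c]>)%VS ->
    (forall a b, proper_vec a -> proper_vec b ->
       lbr (E a) (E b) = (rule a b)%:R *: E (a + b)) ->
  lie_simple W.
Proof.
move=> ruleP E0 E1 spanE lbrE I idealI.
have [-> | nzI] := eqVneq I 0%VS; [by left | right].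
have [a [s [t [ev_a pr_a nz_st aI]]]] :=
  ideal_pair ruleP E0 E1 spanE lbrE idealI nzI.
have pureI := ideal_pure ruleP E0 E1 spanE lbrE idealI.
have [t0 | nz_t] := eqVneq t 0.
  apply: pureI pr_a _; rewrite t0 eqxx orbF in nz_st; move: aI.
  by rewrite t0 scale0r addr0 => /(memvZ s^-1); rewrite scalerA mulVf ?scale1r.
(* Bracketing with E b at the index h of [rule_pure] leaves only the term with
   coefficient t. *)
have [h [b [ev_h pr_h pr_b pr_bh /andP[bh0 bh1]]]] := rule_pure ruleP.
have hI : s *: E h + t *: E (h + ones) \in I.
  apply: (@even_connected (fun c => s *: E c + t *: E (c + ones) \in I) a h) => //.
    by move=> g c; apply: (ideal_step ruleP lbrE idealI).
  by apply: F2_eq; rewrite (negPf ev_a) (negPf ev_h).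
have pr_bh1 : proper_vec (b + h + ones) by rewrite proper_addones.
apply: pureI pr_bh1 _; move/(idealI (E b)): hI.
rewrite lbrDr !lbrZr !lbrE ?proper_addones // (negPf bh0) bh1.
rewrite scale0r scaler0 add0r scale1r addrA.
by move/(memvZ t^-1); rewrite scalerA mulVf // scale1r.
Qed.

(** * The derived algebra and its scalar extensions *)

Section DerivedGrading.
Variables (k : fieldType) (V : lieAlgType k) (e : 'rV['F_2]_n -> V).
Variable rule : rel 'rV['F_2]_n.
Hypotheses (ruleP : splitting_rule rule) (e0 : e 0 = 0).
Hypothesis spane : fullv = (\sum_c <[e c]>)%VS.
Hypothesis lbre : forall a b, lbr (e a) (e b) = (rule a b)%:R *: e (a + b).

Lemma proper_derived c : proper_vec c -> e c \in derived V.
Proof.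
case/even_detects=> h ev_h hc.
have := lbr_derived (e h) (e (h + c)).
by rewrite lbre addKv (rule_dot ruleP) ?dot_step // scale1r.
Qed.

Lemma derivedE : derived V = (\sum_(c | proper_vec c) <[e c]>)%VS.
Proof.
apply/eqP; rewrite eqEsubv; apply/andP; split; last first.
  by apply/subv_sumP=> c /proper_derived; rewrite memvE.
apply/span_subvP=> _ /allpairsP[[x y] [_ _ ->]] /=.
have /memv_sumP[us usE ->] : x \in (\sum_c <[e c]>)%VS by rewrite -spane memvf.
have /memv_sumP[vs vsE ->] : y \in (\sum_c <[e c]>)%VS by rewrite -spane memvf.
rewrite lbr_suml memv_suml // => a _; rewrite lbr_sumr memv_suml // => b _.
have [/vlineP[s ->] /vlineP[t ->]] := (usE a isT, vsE b isT).
rewrite lbrZl lbrZr lbre 2?memvZ //.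
have [pr_ab | ] := boolP (proper_vec (a + b)).
  by rewrite memvZ // memvE (sumv_sup (a + b)).
rewrite /proper_vec negb_and !negbK !addv_eq addr0 => /orP[] /eqP->.
  by rewrite addvv e0 scaler0 mem0v.
by rewrite (rule_ones ruleP) scale0r mem0v.
Qed.

(** The derived algebra is a sum of 2^n - 2 lines, which bounds its dimension from
above. As e 0 = 0, adding the line of e_ones gives the whole space, which bounds it
from below. *)
Lemma dim_derived : \dim {:V} = (2 ^ n - 1)%N -> \dim (derived V) = (2 ^ n - 2)%N.
Proof.
move=> dimV; have card_vec : #|{: 'rV['F_2]_n}| = (2 ^ n)%N.
  by rewrite card_mx card_Fp // mul1n.
have card_proper : #|[pred c | proper_vec c]| = (2 ^ n - 2)%N.
  have := cardC (pred2 (0 : 'rV['F_2]_n) ones).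
  rewrite card2 eq_sym ones_neq0 card_vec => <-; rewrite addKn.
  by apply: eq_card => c; rewrite !inE negb_or.
have dim_line (v : V) : (\dim <[v]> <= 1)%N by rewrite dim_vline leq_b1.
apply/eqP; rewrite eqn_leq; apply/andP; split.
  rewrite derivedE (leq_trans (dimv_leq_sum _ _ _)) // -card_proper -sum1_card.
  exact: leq_sum.
rewrite -[2%N]/(1 + 1)%N subnDA -dimV spane (bigD1 0) //=.
rewrite (bigD1 ones) ?ones_neq0 //= -derivedE e0 leq_subLR add0v.
exact: leq_trans (dimv_add_leqif _ _) (leq_add (dim_line _) (leqnn _)).
Qed.

Lemma absolutely_simple_derived : absolutely_simple (derived_alg V).
Proof.
move=> K iota.
(* The zero values at 0 and ones turn d into a family indexed by all vectors,
   for which the bracket rule needs no exception when a + b is improper. *)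
pose d c : derived_alg V := if proper_vec c then vsproj (derived V) (e c) else 0.
have dE c : vsval (d c) = if proper_vec c then e c else 0.
  by rewrite /d; case: ifP => // /proper_derived /vsprojK.
pose E c := scalar_ext_in iota (d c).
apply: (@graded_lie_simple _ _ E rule ruleP).
- by rewrite /E /d /proper_vec eqxx scalar_ext_in0.
- by rewrite /E /d /proper_vec eqxx andbF scalar_ext_in0.
- apply/esym/eqP; rewrite eqEsubv subvf /=; apply/subvP=> u _.
  rewrite [u]scalar_ext_gen memv_suml // => i _; rewrite memvZ //.
  move: (_`_i) => x; have := subvsP x.
  have subD v : v \in derived V -> v \in (\sum_(c | proper_vec c) <[e c]>)%VS.
    by rewrite derivedE.
  move/subD=> /memv_sumP[us usE Dx].
  have DusP c : proper_vec c -> exists t, vsproj (derived V) (us c) = t *: d c.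
    move=> pr_c; have /vlineP[t Dt] := usE c pr_c.
    by exists t; rewrite Dt linearZ /d pr_c.
  have -> : x = \sum_(c | proper_vec c) vsproj (derived V) (us c).
    by rewrite -linear_sum -Dx; apply/esym/vsvalK.
  rewrite scalar_ext_in_sum memv_suml // => c pr_c.
  have [t ->] := DusP c pr_c; rewrite scalar_ext_inZ memvZ //.
  by rewrite memvE (sumv_sup c).
- move=> a b pr_a pr_b.
  rewrite -[LHS](scalar_ext_in_lbr iota (d a) (d b)).
  have -> : lbr (d a) (d b) = (rule a b)%:R *: d (a + b).
    apply: val_inj.
    have -> : val (lbr (d a) (d b)) = lbr (vsval (d a)) (vsval (d b)) by [].
    rewrite linearZ /= !dE pr_a pr_b lbre; case: ifP => // /negbT.
    rewrite /proper_vec negb_and !negbK !addv_eq addr0 => /orP[] /eqP->.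
      by rewrite addvv e0.
    by rewrite (rule_ones ruleP) !scale0r.
  by rewrite scalar_ext_inZ rmorph_nat.
Qed.

End DerivedGrading.

(** * The rules of the two algebras *)

Lemma alpha_last_unitv (i : 'I_n) : i.+1 = n -> alpha_last n = unitv i.
Proof.
move=> Di; apply/rowP=> j; rewrite unitvE mxE.
by have -> : (j == i) = (j.+1 == i.+1) by []; rewrite Di.
Qed.

Lemma coord_proper a i j : a 0 i == 1 -> a 0 j != 1 -> proper_vec a.
Proof.
move=> ai aj; apply/andP; split; apply: contraTneq ai => Da.
  by rewrite Da mxE.
by move: aj; rewrite Da mxE.
Qed.

(** A unit vector at one of the first four coordinates is orthogonal to [alpha_last]
as n >= 5, so the rule of N_1 gives its brackets. For [rule_pure], take h the sum of
the first two unit vectors and b the third one: b and h are orthogonal and h is even,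
whereas b and h + ones are both odd. *)
Lemma N1_like_splitting (rule : rel 'rV['F_2]_n) : (5 <= n)%N ->
    (forall h a, parity h != 1 -> rule h a && rule h (h + a) = (dot h a == 1)) ->
    (forall a, rule a (a + ones) = false) ->
    (forall a b, dot a (alpha_last n) != 1 -> rule a b = N1_rule a b) ->
  splitting_rule rule.
Proof.
move=> n_ge5 rule_sq rule_1 ruleE.
have [lt0 lt1 lt2 lt3] : [/\ 0 < n, 1 < n, 2 < n & 3 < n]%N.
  by split; apply: leq_trans n_ge5.
pose i0 := Ordinal lt0; pose i1 := Ordinal lt1.
pose i2 := Ordinal lt2; pose i3 := Ordinal lt3.
have ruleE' (i : 'I_n) b : (i < 4)%N -> rule (unitv i) b = N1_rule (unitv i) b.
  move=> lt_i4; apply: ruleE; rewrite dot_unitv mxE.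
  by rewrite [_ == n]ltn_eqF ?(leq_trans _ n_ge5).
have pr_01 : proper_vec (unitv i0 + unitv i1).
  by apply: (@coord_proper _ i0 i2); rewrite !mxE.
split=> //.
  exists (unitv i0 + unitv i1), (unitv i2); split=> //.
  - by rewrite parityD !parity_unitv.
  - by apply: (@coord_proper _ i2 i3); rewrite !mxE.
  - by apply: (@coord_proper _ i2 i3); rewrite !mxE.
  by rewrite !ruleE' // /N1_rule !parityD !dot_unitv !parity_unitv odd_ones !mxE.
exists (unitv i0), (unitv i1); rewrite !parity_unitv; split=> //.
- by apply: (@coord_proper _ i0 i3); rewrite !mxE.
- by apply: (@coord_proper _ i1 i3); rewrite !mxE.
by rewrite pr_01 ruleE' // /N1_rule !parity_unitv.
Qed.

Lemma N1_splitting : (5 <= n)%N -> splitting_rule (@N1_rule n).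
Proof.
move=> n_ge5; apply: N1_like_splitting => // [h a ev_h | a].
  rewrite /N1_rule !(parityD, dotDr, F2_addE) dotvv (negPf ev_h).
  by case: (dot h a == 1).
rewrite /N1_rule !(parityD, dotDr, F2_addE) dotvv dotv1 odd_ones.
by case: (parity a == 1).
Qed.

(** For h even, the rule of N_2 gives (h,c), except that it gives 1 when h and c both
have last coordinate 1. If h has last coordinate 1, then this happens for exactly one
of c = a and c = h + a, and the other factor of [rule_sqr] is still (h,a). *)
Lemma N2_splitting : (5 <= n)%N -> splitting_rule (@N2_rule n).
Proof.
move=> n_ge5; have n_gt0 : (0 < n)%N by apply: leq_trans n_ge5.
have lt_last : (n.-1 < n)%N by rewrite prednK.
have ones_last : dot ones (alpha_last n) = 1.
  rewrite (@alpha_last_unitv (Ordinal lt_last)); last exact: prednK.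
  by rewrite dotC dotv1 parity_unitv.
apply: N1_like_splitting => // [h a ev_h | a | a b a_last].
- rewrite /N2_rule !(parityD, dotDl, dotDr, F2_addE) dotvv (negPf ev_h).
  by case: (dot h a == 1); case: (dot h _ == 1); case: (dot a _ == 1).
- rewrite /N2_rule !(parityD, dotDl, dotDr, F2_addE) dotvv dotv1 odd_ones ones_last.
  by case: (parity a == 1); case: (dot a _ == 1).
by rewrite /N2_rule (negPf a_last).
Qed.

End Vectors.

(** * The algebra defined by a rule *)

Section RuleAlgebra.
Variables (n : nat) (k : fieldType).
Local Notation V := {ffun Phi n -> k^o}.

Lemma dim_ruleV : \dim {:V} = (2 ^ n - 1)%N.
Proof.
rewrite dimvf.
have -> : dim V = (#|Phi n| * 1)%N by [].
rewrite muln1 card_sig.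
have := cardC (pred1 (0 : 'rV['F_2]_n)).
rewrite card1 card_mx card_Fp // mul1n => <-; rewrite addKn.
by apply: eq_card.
Qed.

Lemma span_ebase : {:V}%VS = (\sum_c <[@ebase n k c]>)%VS.
Proof.
apply/esym/eqP; rewrite eqEsubv subvf /=; apply/subvP=> x _.
rewrite [x]ebase_gen memv_suml // => c _; rewrite memvZ //.
by rewrite memvE (sumv_sup (val c)).
Qed.

(** Since [ebase 0] is 0, the bracket rule needs no exception for equal or zero
indices. *)
Lemma rule_br_ebaseE (rule : rel 'rV['F_2]_n) : lie_rule rule -> forall a b,
  rule_br rule (ebase k a) (ebase k b) = (rule a b)%:R *: @ebase n k (a + b).
Proof.
move=> [ruleC rule0 _] a b.
have [-> | nz_a] := eqVneq a 0.
  rewrite rule0 scale0r ebase0 /rule_br big1 // => c _.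
  by rewrite big1 // => d _; rewrite ffunE mul0r scale0r.
have [-> | nz_b] := eqVneq b 0.
  rewrite ruleC rule0 scale0r ebase0 /rule_br big1 // => c _.
  by rewrite big1 // => d _; rewrite [X in _ * X]ffunE mulr0 scale0r.
have := rule_br_ebase k rule (Sub a nz_a) (Sub b nz_b); rewrite /= => ->.
rewrite /ebase_br; case: eqP => [<- | _] /=; first by rewrite addvv ebase0 scaler0.
by case: (rule a b); rewrite ?scale1r ?scale0r.
Qed.

End RuleAlgebra.

Lemma parity_ones_odd m : parity (ones (2 * m + 1)) = 1.
Proof.
rewrite /parity; under eq_bigr do rewrite mxE.
rewrite sumr_const card_ord natrD natrM (_ : 2%:R = 0) ?mul0r ?add0r //.
exact: F2_eq.
Qed.

Theorem theorem5p3 (k : fieldType) (pchar2 : 2%N \in [pchar k]) (m n : nat)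
    (Dn : n = (2 * m + 1)%N) (m_ge2 : (2 <= m)%N) :
  (absolutely_simple (derived_alg (N1 n pchar2)) /\
   \dim (derived (N1 n pchar2)) = (2 ^ n - 2)%N) /\
  (absolutely_simple (derived_alg (N2 n pchar2)) /\
   \dim (derived (N2 n pchar2)) = (2 ^ n - 2)%N).
Proof.
have odd_n : parity (ones n) = 1 by rewrite Dn parity_ones_odd.
have n_ge5 : (5 <= n)%N by rewrite Dn addn1 ltnS (leq_mul2l 2 2).
have split1 := N1_splitting odd_n n_ge5.
have split2 := N2_splitting odd_n n_ge5.
have lbr1 := rule_br_ebaseE k (N1_lie_rule n).
have lbr2 := rule_br_ebaseE k (N2_lie_rule n).
have e0 := ebase0 n k; have spanV := span_ebase n k; have dimV := dim_ruleV n k.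
split; split.
- exact: (@absolutely_simple_derived n odd_n k (N1 n pchar2) _ _ split1 e0 spanV lbr1).
- exact: (@dim_derived n odd_n k (N1 n pchar2) _ _ split1 e0 spanV lbr1 dimV).
- exact: (@absolutely_simple_derived n odd_n k (N2 n pchar2) _ _ split2 e0 spanV lbr2).
- exact: (@dim_derived n odd_n k (N2 n pchar2) _ _ split2 e0 spanV lbr2 dimV).
Qed.
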